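(* Let $d\ge 2$ be an integer, let $\mathbf{K}$ be an ellipsoid in $\mathbb{R}^d$, and let $r\ge 1$ be an integer. Let $C_1,\dots,C_N$ be $1$-codimensional cylinders in $\mathbb{R}^d$ which form an $r$-fold packing in $\mathbf{K}$. Then $$\sum_{i=1}^N \mathrm{crv}_{\mathbf{K}}(C_i)\le r .$$
   Context: A convex body in $\mathbb{R}^d$ is a compact convex set with non-empty interior. $P_E$ denotes the orthogonal projection onto a linear subspace $E\subset\mathbb{R}^d$, $E^\perp$ the orthogonal complement of $E$, and $\mathrm{vol}_m$ the $m$-dimensional volume. For $0<k<d$, a $k$-codimensional cylinder is a set $C\subset\mathbb{R}^d$ that can be presented in the form $C=B+H$, where $H$ is a $k$-dimensional linear subspace of $\mathbb{R}^d$ and $B$ is a measurable set in $E:=H^\perp$. For a convex body $\mathbf{K}$ in $\mathbb{R}^d$ and a $k$-codimensional cylinder $C=B+H$ with $E=H^\perp$, the crossectional volume of $C$ with respect to $\mathbf{K}$ is $$\mathrm{crv}_{\mathbf{K}}(C)=\frac{\mathrm{vol}_{d-k}(B)}{\mathrm{vol}_{d-k}(P_E\mathbf{K})}.$$ Let $\mathbf{K}$ be a convex body in $\mathbb{R}^d$, let $C_i=B_i+H_i$, $i\le N$, be $k$-codimensional cylinders, $E_i=H_i^\perp$ and $\bar C_i=C_i\cap\mathbf{K}$. The $C_i$'s form an $r$-fold packing in $\mathbf{K}$ if $B_i\subset P_{E_i}\mathbf{K}$ for every $i\le N$ and each point of $\mathbf{K}$ belongs to at most $r$ of the interiors $\mathrm{int}(\bar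 C_i)$.
   Formalization: Each base B_i is additionally assumed to be open up to a null set: B_i minus its interior relative to E_i has (d-1)-volume zero. Without this the claim fails, e.g. for two copies of a cylinder over the irrational points of the projection of a disc, with r=1. *)

(* Defs.v *)
From HB Require Import structures.
From mathcomp Require Import all_boot all_order all_algebra.
From mathcomp Require Import all_classical all_reals all_analysis.
Import Order.TTheory GRing.Theory Num.Theory numFieldNormedType.Exports.

Set Implicit Arguments.
Unset Strict Implicit.
Unset Printing Implicit Defensive.

Local Open Scope classical_set_scope.
Local Open Scope ring_scope.

Section Cylinders.
Variable R : realType.

Definition dot (d : nat) (x y : 'rV[R]_d) : R := (x *m y^T) 0 0.

Definition orth (d : nat) (A : set 'rV[R]_d) : set 'rV[R]_d :=
  [set x | forall y, A y -> dot x y = 0].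

(* [P_E K], for [E] a linear subspace *)
Definition orth_proj (d : nat) (E K : set 'rV[R]_d) : set 'rV[R]_d :=
  [set y | E y /\ exists2 x, K x & orth E (x - y)].

Definition box (m : nat) (a b : 'rV[R]_m) : set 'rV[R]_m :=
  [set x | forall j, x 0 j \in `]a 0 j, b 0 j]].

(* Lebesgue outer measure on R^m, as the infimum of the total volume of the
   countable covers by boxes; meaningful only for 0 < m. *)
Definition lebesgue_outer (m : nat) (A : set 'rV[R]_m) : \bar R :=
  ereal_inf [set z | exists a b : nat -> 'rV[R]_m,
    [/\ forall n j, a n 0 j <= b n 0 j,
        A `<=` \bigcup_n box (a n) (b n) &
        z = (\sum_(0 <= n <oo) (\prod_j (b n 0 j - a n 0 j))%:E)%E]].

(* The rows of [Q] form an orthonormal basis of [E]. *)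
Definition orthonormal_basis (m d : nat) (E : set 'rV[R]_d)
    (Q : 'M[R]_(m, d)) : Prop :=
  Q *m Q^T = 1%:M /\ E = [set y *m Q | y in [set: 'rV[R]_m]].

(* [B], a subset of the m-dimensional subspace [E], in coordinates with respect
   to some orthonormal basis of [E]; Lebesgue measurability and measure do not
   depend on the choice of this basis. *)
Definition coords (m d : nat) (E B : set 'rV[R]_d) : set 'rV[R]_m :=
  [set y | B (y *m xget (0 : 'M[R]_(m, d)) [set Q | orthonormal_basis E Q])].

Arguments coords m {d} E B.

Definition subspace_measurable (m d : nat) (E B : set 'rV[R]_d) : Prop :=
  (@lebesgue_outer m).-caratheodory (coords m E B).

Definition subspace_vol (m d : nat) (E B : set 'rV[R]_d) : \bar R :=
  lebesgue_outer (coords m E B).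

Arguments subspace_measurable m {d} E B.
Arguments subspace_vol m {d} E B.

Record cylinder (d k : nat) := Cylinder {
  cyl_dir : {vspace 'rV[R]_d} ;
  cyl_base : set 'rV[R]_d ;
  cyl_codim : (0 < k < d)%N ;
  cyl_dimv : \dim cyl_dir = k ;
  cyl_base_sub : cyl_base `<=` orth [set` cyl_dir] ;
  cyl_base_measurable :
    subspace_measurable (d - k) (orth [set` cyl_dir]) cyl_base }.

Definition cyl_orth (d k : nat) (C : cylinder d k) : set 'rV[R]_d :=
  orth [set` cyl_dir C].

Definition cyl_set (d k : nat) (C : cylinder d k) : set 'rV[R]_d :=
  [set b + h | b in cyl_base C & h in [set` cyl_dir C]].

Definition crv (d k : nat) (K : set 'rV[R]_d) (C : cylinder d k) : \bar R :=
  (subspace_vol (d - k) (cyl_orth C) (cyl_base C) /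
   subspace_vol (d - k) (cyl_orth C) (orth_proj (cyl_orth C) K))%E.

Definition fold_packing (d k N r : nat) (K : set 'rV[R]_d)
    (C : 'I_N -> cylinder d k) : Prop :=
  (forall i, cyl_base (C i) `<=` orth_proj (cyl_orth (C i)) K) /\
  (forall x, K x -> (#|[pred i | `[< (cyl_set (C i) `&` K)° x >] ]| <= r)%N).

Definition relint (d : nat) (E B : set 'rV[R]_d) : set 'rV[R]_d :=
  [set x | E x /\ \forall y \near within E (nbhs x), B y].

(* The base is open up to a null set.  Without this, a base of positive volume
   may have empty interior (say, the points of a ball with an irrational
   coordinate), and packings, which only involve interiors, would not see it. *)
Definition regular_base (d k : nat) (C : cylinder d k) : Prop :=
  subspace_vol (d - k) (cyl_orth C)
    (cyl_base C `\` relint (cyl_orth C) (cyl_base C)) = 0%E.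

Definition ellipsoid (d : nat) (K : set 'rV[R]_d) : Prop :=
  exists (A : 'M[R]_d) (c : 'rV[R]_d),
    A \in unitmx /\ K = [set x *m A + c | x in [set x | dot x x <= 1]].

End Cylinders.

(* Main.v *)
Require Import Defs.
From HB Require Import structures.
From mathcomp Require Import all_boot all_order all_algebra.
From mathcomp Require Import all_classical all_reals all_analysis.
From mathcomp Require Import measurable_realfun ring lra.

(** The proof rests on a generalisation of the theorem of Archimedes on the
    sphere.  Give the open ellipsoid gauge < 1, where gauge is the square of a
    Euclidean norm around the centre, the density w = 1 / sqrt (1 - gauge).
    Along a line of direction h, the function 1 - gauge is a concave quadratic
    polynomial whose leading coefficient depends on h only.  If the line meets
    the open ellipsoid, an affine change of variable turns the integral of w
    along it into a multiple of the integral of 1 / sqrt (1 - s^2) over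
    ]-1, 1[, and this multiple depends on h alone ([arcsine_mass_chord]).
    Hence, for the measure w dx, the mass of the part of the ellipsoid above a
    base B in the hyperplane orthogonal to h is proportional to the volume of
    B ([ell_density_projection]): crv(C) is the proportion of the w-mass of K
    that the cylinder C carries.  No point of K is interior to more than r of
    the cylinders, and the bases are open up to null sets, so these proportions
    add up to at most r.

    Each cylinder comes with its own orthonormal coordinates, so the masses
    obtained in different coordinates have to be compared.  Since crv is a
    quotient, it is enough to know that a linear change of variables multiplies
    all integrals by one and the same positive constant; this is the uniqueness
    of Haar measure up to a factor, and it follows from Tonelli's theorem and
    translation invariance ([haar_exchange], [ge0_integral_linear]), without
    determinants or rotations.

    The measure on row vectors is the iterated product of the one-dimensional
    Lebesgue measure, which makes integration along lines available by
    construction.  The volume of the bases is instead an infimum over covers by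
    boxes.  Only two inequalities between them are used.  A measurable set has
    measure at most its outer volume ([leb_rV_le_outer]): this serves for the
    projection of K, in the denominator.  A set contained in an open set up to
    a null set has outer volume at most the measure of that open set
    ([lebesgue_outer_le_open]): this serves for the base, whose relative
    interior is what the packing condition controls. *)

Set Implicit Arguments.
Unset Strict Implicit.
Unset Printing Implicit Defensive.

Import Order.TTheory GRing.Theory Num.Theory numFieldNormedType.Exports.

Local Open Scope classical_set_scope.
Local Open Scope ring_scope.

(** * Measurable structure and Lebesgue measure on row vectors *)

Definition rV_display : measure_display. Proof. exact. Qed.

Section measurable_rV.
Context {R : realType} {m : nat}.

(** The sigma-algebra of the coordinate functions: a map into ['rV_m] is then
    measurable as soon as its coordinates are.  That it contains the open sets
    is a consequence of the dyadic decomposition [open_boxes]. *)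
Definition rV_cylinders : set (set 'rV[R]_m) :=
  [set A | exists j : 'I_m, exists2 B : set R, measurable B &
    A = (fun x : 'rV[R]_m => x 0 j) @^-1` B].

Let rV_set0 : <<s rV_cylinders >> set0. Proof. exact: sigma_algebra0. Qed.
Let rV_setC A : <<s rV_cylinders >> A -> <<s rV_cylinders >> (~` A).
Proof. by move=> ?; rewrite -setTD; exact: sigma_algebraCD. Qed.
Let rV_bigcup (F : _^nat) : (forall i, <<s rV_cylinders >> (F i)) ->
  <<s rV_cylinders >> (\bigcup_i (F i)).
Proof. exact: sigma_algebra_bigcup. Qed.

HB.instance Definition _ := @isMeasurable.Build rV_display 'rV[R]_m
  <<s rV_cylinders >> rV_set0 rV_setC rV_bigcup.

Lemma measurable_coord (j : 'I_m) :
  measurable_fun [set: 'rV[R]_m] (fun x : 'rV[R]_m => x 0 j).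
Proof.
move=> _ B mB; rewrite setTI; apply: sub_sigma_algebra.
by exists j, B.
Qed.

Lemma measurable_fun_rV d (T : measurableType d) (f : T -> 'rV[R]_m) :
  (forall j, measurable_fun [set: T] (fun t => f t 0 j)) ->
  measurable_fun [set: T] f.
Proof.
move=> mf; apply: (@measurability _ _ T 'rV[R]_m setT f rV_cylinders) => //.
move=> _ [_ [j [B mB ->]] <-].
exact: (mf j measurableT B mB).
Qed.

End measurable_rV.

Lemma measurable_mulmxr (R : realType) (m n : nat) (P : 'M[R]_(m, n)) :
  measurable_fun [set: 'rV[R]_m] (fun x => x *m P).
Proof.
apply: measurable_fun_rV => j.
under eq_fun do rewrite mxE.
apply: measurable_sum => i; apply: measurable_funM => //; exact: measurable_coord.
Qed.

Lemma measurable_fun_addrV d (T : measurableType d) (R : realType) (m : nat)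
    (f g : T -> 'rV[R]_m) :
  measurable_fun setT f -> measurable_fun setT g ->
  measurable_fun setT (fun x => f x + g x).
Proof.
move=> mf mg; apply: measurable_fun_rV => j.
under eq_fun do rewrite mxE.
apply: measurable_funD; first exact: (measurableT_comp (measurable_coord j) mf).
exact: (measurableT_comp (measurable_coord j) mg).
Qed.

Section rV_cons.
Context {R : realType} {m : nat}.

Definition rV_cons (p : 'rV[R]_m * R) : 'rV[R]_(1 + m) := row_mx p.2%:M p.1.

Definition rV_uncons (x : 'rV[R]_(1 + m)) : 'rV[R]_m * R :=
  (rsubmx x, lsubmx x 0 0).

Lemma rV_consl p (i : 'I_1) : rV_cons p 0 (lshift m i) = p.2.
Proof. by rewrite /rV_cons row_mxEl mxE (ord1 i) eqxx mulr1n. Qed.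

Lemma rV_consr p j : rV_cons p 0 (rshift 1 j) = p.1 0 j.
Proof. by rewrite /rV_cons row_mxEr. Qed.

Lemma rV_consK : cancel rV_cons rV_uncons.
Proof.
by move=> [y t]; rewrite /rV_uncons /rV_cons row_mxKr row_mxKl mxE eqxx mulr1n.
Qed.

Lemma rV_unconsK : cancel rV_uncons rV_cons.
Proof.
by move=> x; rewrite /rV_uncons /rV_cons /= -mx11_scalar hsubmxK.
Qed.

Lemma rV_consD p v : rV_cons p + v =
  rV_cons (p.1 + (rV_uncons v).1, p.2 + (rV_uncons v).2).
Proof.
rewrite -{1}[v]rV_unconsK /rV_cons add_row_mx /=.
by rewrite raddfD.
Qed.

Lemma measurable_rV_cons : measurable_fun setT rV_cons.
Proof.
apply: measurable_fun_rV => j; rewrite /rV_cons.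
case: (split_ordP j) => k ->.
- under eq_fun do rewrite row_mxEl mxE.
  rewrite (ord1 k) eqxx /=.
  by under eq_fun do rewrite mulr1n; exact: measurable_snd.
- under eq_fun do rewrite row_mxEr.
  exact: (measurableT_comp (measurable_coord k) measurable_fst).
Qed.

Lemma measurable_rV_uncons : measurable_fun setT rV_uncons.
Proof.
apply/measurable_fun_pairP; split; rewrite /rV_uncons /comp /=.
- apply: measurable_fun_rV => j; under eq_fun do rewrite mxE.
  exact: measurable_coord.
- under eq_fun do rewrite mxE; exact: measurable_coord.
Qed.

Variable mu : {sigma_finite_measure set 'rV[R]_m -> \bar R}.

(** The product measure carried by [rV_cons], so that integration over
    ['rV_(1 + m)] is integration along the lines of the first coordinate. *)
Definition cons_measure : set 'rV[R]_(1 + m) -> \bar R :=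
  pushforward (mu \x lebesgue_measure)%E rV_cons.

Let cons_measure0 : cons_measure set0 = 0%E.
Proof. by rewrite /cons_measure /pushforward preimage_set0 measure0. Qed.
Let cons_measure_ge0 A : (0 <= cons_measure A)%E.
Proof. by rewrite /cons_measure /pushforward; exact: measure_ge0. Qed.
Let cons_measure_sigma_additive : semi_sigma_additive cons_measure.
Proof.
move=> F mF tF mUF; rewrite /cons_measure /pushforward preimage_bigcup.
apply: measure_semi_sigma_additive.
- by move=> n; rewrite -[X in measurable X]setTI; exact: measurable_rV_cons.
- apply/trivIsetP => /= i j _ _ ij; rewrite -preimage_setI.
  by move/trivIsetP : tF => /(_ _ _ _ _ ij) ->//; rewrite preimage_set0.
- by rewrite -preimage_bigcup -[X in measurable X]setTI; exact: measurable_rV_cons.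
Qed.

HB.instance Definition _ := isMeasure.Build _ _ _ cons_measure
  cons_measure0 cons_measure_ge0 cons_measure_sigma_additive.

Let cons_measure_sigma_finite : sigma_finite setT cons_measure.
Proof.
have /sigma_finiteP[F [FT ndF Foo]] := sigma_finiteT mu.
have /sigma_finiteP[G [GT ndG Goo]] := sigma_finiteT (@lebesgue_measure R).
exists (fun n => rV_uncons @^-1` (F n `*` G n)).
  apply/esym/seteqP; split => // x _.
  have [i _ Fi] : (\bigcup_i F i) (rV_uncons x).1 by rewrite -FT.
  have [j _ Gj] : (\bigcup_i G i) (rV_uncons x).2 by rewrite -GT.
  exists (maxn i j) => //; split.
    by move: Fi; exact/subsetPset/ndF/leq_maxl.
  by move: Gj; exact/subsetPset/ndG/leq_maxr.
move=> n; have [mFn Fn] := Foo n; have [mGn Gn] := Goo n; split.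
  by rewrite -[X in measurable X]setTI; apply: measurable_rV_uncons => //;
    exact: measurableX.
rewrite /cons_measure /pushforward -comp_preimage.
rewrite (_ : rV_uncons \o rV_cons = id); last first.
  by apply/funext => p /=; rewrite rV_consK.
by rewrite preimage_id product_measure1E// lte_mul_pinfty// ge0_fin_numE.
Qed.

HB.instance Definition _ := @Measure_isSigmaFinite.Build _ _ _ cons_measure
  cons_measure_sigma_finite.

End rV_cons.

Fixpoint leb_rV (R : realType) (m : nat) :
    {sigma_finite_measure set 'rV[R]_m -> \bar R} :=
  match m with
  | 0 => [the {sigma_finite_measure set 'rV[R]_0 -> \bar R} of dirac (0 : 'rV[R]_0)]
  | m'.+1 => [the {sigma_finite_measure set 'rV[R]_(1 + m') -> \bar R} of
      cons_measure (leb_rV R m')]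
  end.

Arguments leb_rV : simpl never.

Lemma measurable_box (R : realType) (m : nat) (a b : 'rV[R]_m) :
  measurable (box a b).
Proof.
rewrite (_ : box a b = \bigcap_(j in [set: 'I_m])
    (fun x : 'rV[R]_m => x 0 j) @^-1` `]a 0 j, b 0 j]).
  apply: fin_bigcap_measurable => // j _.
  by rewrite -[X in measurable X]setTI; exact: measurable_coord.
by apply/seteqP; split => x /= h j; [move=> _|]; apply: h.
Qed.

Lemma leb_rV_box (R : realType) (m : nat) (a b : 'rV[R]_m) :
  (forall j, a 0 j <= b 0 j) ->
  leb_rV R m (box a b) = (\prod_j (b 0 j - a 0 j))%:E.
Proof.
elim: m a b => [|m IH] a b ab.
  rewrite big_ord0 /= diracE mem_set //.
  by case.
rewrite /leb_rV -/leb_rV /= /cons_measure /pushforward.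
set a' : 'rV[R]_(1 + m) := a; set b' : 'rV[R]_(1 + m) := b.
rewrite (_ : rV_cons @^-1` _ =
    box (rsubmx a') (rsubmx b') `*` `]a' 0 (lshift m 0), b' 0 (lshift m 0)]).
  rewrite product_measure1E//; last exact: measurable_box.
  have E : leb_rV R m (box (rsubmx a') (rsubmx b')) =
      (\prod_j (rsubmx b' 0 j - rsubmx a' 0 j))%:E.
    by apply: IH => j; rewrite !mxE; exact: ab.
  rewrite [X in (X * _)%E = _]E.
  rewrite /= lebesgue_measure_itv /= lte_fin.
  have -> : \prod_(j < m.+1) (b' 0 j - a' 0 j) =
      (b' 0 (lshift m 0) - a' 0 (lshift m 0)) *
      \prod_(j < m) (rsubmx b' 0 j - rsubmx a' 0 j).
    rewrite big_ord_recl; congr *%R.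
      by rewrite (_ : lshift m 0 = ord0) //; exact: val_inj.
    apply: eq_bigr => j _; rewrite !mxE.
    by rewrite (_ : lift ord0 j = rshift 1 j) //; exact: val_inj.
  have ab' : forall j : 'I_(1 + m), a' 0 j <= b' 0 j by exact: ab.
  have := ab' (lshift m 0); rewrite le_eqVlt => /orP[/eqP e|lt].
    by rewrite /a' /b' e ltxx mule0 subrr mul0r.
  by rewrite lt -EFinM mulrC.
apply/seteqP; split => -[y t] /=.
  move=> h; split => /=.
    by move=> j; have := h (rshift 1 j); rewrite rV_consr !mxE.
  by have := h (@lshift 1 m 0); rewrite rV_consl.
move=> [hy ht] j; case: (split_ordP (j : 'I_(1 + m))) => k ->.
  by rewrite rV_consl (ord1 k).
by rewrite rV_consr; have := hy k; rewrite !mxE.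
Qed.

Section affine_substitution.
Local Open Scope ereal_scope.
Context {R : realType}.
Variables (a b : R).
Hypothesis a0 : (0 < a)%R.

Let phi (t : measurableTypeR R) : measurableTypeR R := (a * t + b)%R.

Let measurable_phi : measurable_fun setT phi.
Proof. by apply: measurable_funD => //; exact: measurable_funM. Qed.

Let preimage_phi (x y : R) :
  phi @^-1` `]x, y]%classic = `]((x - b) / a)%R, ((y - b) / a)%R]%classic.
Proof.
apply/seteqP; split => t /=; rewrite !in_itv /= /phi.
  by rewrite ltr_pdivrMr// ler_pdivlMr// mulrC ltrBlDr lerBrDr.
by rewrite ltr_pdivrMr// ler_pdivlMr// mulrC ltrBlDr lerBrDr.
Qed.

(** The scaled image of Lebesgue measure under an affine map gives intervals
    their length, hence is Lebesgue measure. *)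
Lemma ge0_integral_affine (f : R -> \bar R) :
  measurable_fun setT f -> (forall t, 0 <= f t) ->
  \int[lebesgue_measure]_t f t =
  a%:E * \int[lebesgue_measure]_t f (a * t + b)%R.
Proof.
move=> mf f0.
pose nu : {measure set (measurableTypeR R) -> \bar R} :=
  measure_function_pushforward__canonical__measure_function_Measure
    (@lebesgue_measure R) measurable_phi.
pose nu' := mscale (NngNum (ltW a0)) nu.
rewrite (@eq_measure_integral _ _ _ _ nu'); last first.
  move=> A mA _; apply: lebesgue_measure_unique => //= _ [[x y] _ <-] /=.
  rewrite /nu' /mscale /nu /= /pushforward preimage_phi !lebesgue_measure_itv /=.
  rewrite !lte_fin ltr_pM2r ?invr_gt0// ltrD2r.
  case: ifPn => _; last by rewrite mule0.
  rewrite -!EFinD -EFinM; congr EFin.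
  by field; rewrite gt_eqF.
rewrite ge0_integral_mscale//.
by rewrite ge0_integral_pushforward.
Qed.

End affine_substitution.

Lemma ge0_integral_translation1 (R : realType) (b : R) (f : R -> \bar R) :
  measurable_fun setT f -> (forall t, 0 <= f t)%E ->
  (\int[lebesgue_measure]_t f (t + b)%R = \int[lebesgue_measure]_t f t)%E.
Proof.
move=> mf f0; rewrite (ge0_integral_affine b (@ltr01 R) mf f0) mul1e.
by apply: eq_integral => t _; rewrite mul1r.
Qed.

Section leb_rV_theory.
Local Open Scope ereal_scope.
Context {R : realType}.

(** The coordinate integrated first is the new one: in the application it is
    the parameter along the axis of a cylinder. *)
Lemma leb_rV_tonelli (m : nat) (f : 'rV[R]_(1 + m) -> \bar R) :
  measurable_fun setT f -> (forall x, 0 <= f x) ->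
  \int[leb_rV R (1 + m)]_x f x =
  \int[leb_rV R m]_y \int[lebesgue_measure]_t f (rV_cons (y, t)).
Proof.
move=> mf f0; rewrite /leb_rV -/leb_rV /=.
rewrite ge0_integral_pushforward//; last exact: measurable_rV_cons.
rewrite preimage_setT fubini_tonelli1//; last by move=> p; exact: f0.
by apply: measurableT_comp => //; exact: measurable_rV_cons.
Qed.

Let translation_invariant m := forall (v : 'rV[R]_m) (f : 'rV[R]_m -> \bar R),
  measurable_fun setT f -> (forall x, 0 <= f x) ->
  \int[leb_rV R m]_x f (x + v)%R = \int[leb_rV R m]_x f x.

(** The translation of the new coordinate is one-dimensional; that of the others
    is the induction hypothesis applied to the integral along the lines. *)
Let translation_step m :
  translation_invariant m -> translation_invariant (1 + m).
Proof.
move=> IH v f mf f0.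
have mfv : measurable_fun setT (fun x : 'rV[R]_(1 + m) => f (x + v)%R).
  by apply: measurableT_comp => //; exact: measurable_fun_addrV.
rewrite [RHS](leb_rV_tonelli mf f0).
rewrite [LHS](leb_rV_tonelli mfv (fun x => f0 _)).
pose v' := rV_uncons v.
pose g y := \int[lebesgue_measure]_t f (rV_cons (y, t)).
transitivity (\int[leb_rV R m]_y g (y + v'.1)%R).
  apply: eq_integral => y _; rewrite /g.
  rewrite -(@ge0_integral_translation1 _ v'.2 (fun t => f (rV_cons ((y + v'.1)%R, t))))//.
    by apply: eq_integral => t _; rewrite rV_consD.
  apply: measurableT_comp => //; apply: measurableT_comp => //.
  exact: measurable_rV_cons.
apply: IH => [|y].
  apply: (@measurable_fun_fubini_tonelli_F _ _ _ _ _ lebesgue_measure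
    (fun p => f (rV_cons p))) => //.
  by apply: measurableT_comp => //; exact: measurable_rV_cons.
by apply: integral_ge0.
Qed.

Lemma leb_rV_translation (m : nat) (v : 'rV[R]_m) (f : 'rV[R]_m -> \bar R) :
  measurable_fun setT f -> (forall x, 0 <= f x) ->
  \int[leb_rV R m]_x f (x + v)%R = \int[leb_rV R m]_x f x.
Proof.
move: v f; suff : translation_invariant m by [].
elim: m => [|m IH]; last exact: translation_step.
move=> v f _ _.
by apply: eq_integral => x _; congr f; apply/rowP => -[].
Qed.

End leb_rV_theory.

#[global] Opaque leb_rV.

Lemma integral_indicT d (T : measurableType d) (R : realType)
    (mu : {measure set T -> \bar R}) (A : set T) : measurable A ->
  (\int[mu]_x (\1_A x)%:E = mu A)%E.
Proof. by move=> mA; rewrite integral_indic// setIT. Qed.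

Lemma pos_lty_EFin (R : realType) (x : \bar R) :
  (0 < x)%E -> (x < +oo)%E -> exists2 r : R, 0 < r & x = r%:E.
Proof. by case: x => [r||]//; rewrite lte_fin => r0 _; exists r. Qed.

(** * Comparison with the outer volume *)

Section outer_lower_bound.
Context {R : realType}.
Local Open Scope ereal_scope.

Lemma leb_rV_le_outer (m : nat) (A : set 'rV[R]_m) :
  measurable A -> leb_rV R m A <= lebesgue_outer A.
Proof.
move=> mA; apply/ereal_infP => _ [a [b [ab AU ->]]].
apply: le_trans.
  by apply: (measure_sigma_subadditive _ _ mA AU) => n; exact: measurable_box.
by apply: lee_nneseries => // n _ /=; rewrite (leb_rV_box (ab n)).
Qed.

Lemma lebesgue_outer_le (m : nat) (A B : set 'rV[R]_m) :
  A `<=` B -> lebesgue_outer A <= lebesgue_outer B.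
Proof.
move=> AB; apply: ereal_inf_le_tmp => z [a [b [ab BU ->]]].
by exists a, b; split => //; exact: subset_trans BU.
Qed.

End outer_lower_bound.

Section dyadic.
Context {R : realType} {m : nat}.
Implicit Types (x y : 'rV[R]_m) (k : 'rV[int]_m).

Definition dyadic_index (n : nat) x : 'rV[int]_m :=
  \row_j Num.ceil (2 ^+ n * x 0 j).

Definition dyadic_lower (n : nat) k : 'rV[R]_m :=
  \row_j ((k 0 j - 1)%:~R / 2 ^+ n).

Definition dyadic_upper (n : nat) k : 'rV[R]_m :=
  \row_j ((k 0 j)%:~R / 2 ^+ n).

Definition dyadic (n : nat) k := box (dyadic_lower n k) (dyadic_upper n k).

Lemma dyadicP n k x : dyadic n k x <-> dyadic_index n x = k.
Proof.
have n2 : 0 < 2 ^+ n :> R by rewrite exprn_gt0.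
split=> [h|<- j]; last first.
  rewrite !mxE in_itv /= ltr_pdivrMr// ler_pdivlMr// mulrC.
  exact: ceil_itv.
apply/rowP => j; rewrite mxE; apply/eqP; rewrite ceil_eq.
by have := h j; rewrite !mxE in_itv /= ltr_pdivrMr// ler_pdivlMr// mulrC.
Qed.

(** The integer ceiling of [v] is determined by that of [2 * v]. *)
Lemma dyadic_index_nested n n' x y : (n <= n')%N ->
  dyadic_index n' x = dyadic_index n' y -> dyadic_index n x = dyadic_index n y.
Proof.
move=> /subnK <-; elim: (n' - n)%N => [//|i IH]; rewrite addSn => e; apply: IH.
apply/rowP => j; rewrite !mxE.
have /rowP/(_ j) := e; rewrite !mxE exprS -!mulrA.
set z := _ * x 0 j; set w := _ * y 0 j => zw.
have half (k : int) (v : R) : (Num.ceil v <= k) = (Num.ceil (2 * v) <= 2 * k).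
  by rewrite !ceil_le_int intrM ler_pM2l.
apply/eqP; rewrite eq_le; apply/andP; split.
  by rewrite half zw -half.
by rewrite half -zw -half.
Qed.

Lemma open_dyadic (O : set 'rV[R]_m) x : open O -> O x ->
  exists n, dyadic n (dyadic_index n x) `<=` O.
Proof.
move=> oO Ox.
have /nbhs_ballP[e /= e0 eO] : nbhs x O by apply: open_nbhs_nbhs; split.
have [n ne] : exists n, (2 ^- n < e)%R.
  have [n ne] : exists n : nat, e^-1 < n%:R.
    exists (Num.trunc e^-1).+1; exact: truncnS_gt.
  exists n; rewrite -[ltRHS]invrK ltf_pV2 ?posrE ?exprn_gt0 ?invr_gt0//.
  by apply: lt_trans ne _; rewrite -natrX ltr_nat ltn_expl.
exists n => y /dyadicP yx; apply: eO; split => // i j.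
rewrite (ord1 i); apply: lt_trans ne.
have /rowP/(_ j) := yx; rewrite !mxE => c.
have := ceil_itv (2 ^+ n * y 0 j); rewrite c => /andP[y1 y2].
have /andP[x1 x2] := ceil_itv (2 ^+ n * x 0 j).
have n2 : 0 < 2 ^+ n :> R by rewrite exprn_gt0.
rewrite -[ltRHS]mul1r ltr_pdivlMr// mulrC -{1}(gtr0_norm n2) -normrM mulrBr.
by rewrite ltr_norml; move: x1 x2 y1 y2; rewrite intrB; lra.
Qed.

(** The dyadic cubes contained in [O] that are in no larger such cube.  Dyadic
    cubes are nested or disjoint, so the maximal ones tile [O]. *)
Definition maximal_dyadic (O : set 'rV[R]_m) (p : nat * 'rV[int]_m) : Prop :=
  dyadic p.1 p.2 `<=` O /\
  forall n x, (n < p.1)%N -> dyadic p.1 p.2 x ->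
    ~ (dyadic n (dyadic_index n x) `<=` O).

Lemma maximal_dyadic_cover (O : set 'rV[R]_m) x : open O -> O x ->
  exists2 p, maximal_dyadic O p & dyadic p.1 p.2 x.
Proof.
move=> oO Ox.
have ex : exists n, `[< dyadic n (dyadic_index n x) `<=` O >].
  by have [n h] := open_dyadic oO Ox; exists n; apply/asboolP.
case: (ex_minnP ex) => n /asboolP nO nmin.
exists (n, dyadic_index n x); last exact/dyadicP.
split => //= n' y n'n /dyadicP yx; rewrite (dyadic_index_nested (ltnW n'n) yx).
by move/asboolP => /nmin; rewrite leqNgt n'n.
Qed.

Lemma maximal_dyadic_inj (O : set 'rV[R]_m) p p' x :
  maximal_dyadic O p -> maximal_dyadic O p' ->
  dyadic p.1 p.2 x -> dyadic p'.1 p'.2 x -> p = p'.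
Proof.
move: p p' => [n k] [n' k'] /= [/= kO kmin] [/= k'O k'min] kx k'x.
have /dyadicP e := kx; have /dyadicP e' := k'x.
case: (ltngtP n n') => nn'.
- by case: (k'min n x) => //; rewrite e.
- by case: (kmin n' x) => //; rewrite e'.
- by subst n'; rewrite -e -e'.
Qed.

End dyadic.

(** The dimension is positive so that an empty box has volume zero: indices of
    the enumeration which select no cube are filled with empty boxes. *)
Lemma open_boxes (R : realType) (m : nat) (O : set 'rV[R]_m.+1) : open O ->
  exists a b : nat -> 'rV[R]_m.+1,
    [/\ forall n j, a n 0 j <= b n 0 j, O = \bigcup_n box (a n) (b n) &
        trivIset setT (fun n => box (a n) (b n))].
Proof.
move=> oO.
pose sel (i : nat) := if @pickle_inv (nat * 'rV[int]_m.+1)%type i is Some p then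
  if `[< maximal_dyadic O p >] then Some p else None else None.
have selP i p : sel i = Some p -> maximal_dyadic O p /\ pickle p = i.
  rewrite /sel; have := @pickle_invK (nat * 'rV[int]_m.+1)%type i.
  case: pickle_inv => [q|//] /= <-.
  by case: asboolP => // qO [<-].
pose a i : 'rV[R]_m.+1 := if sel i is Some p then dyadic_lower p.1 p.2 else 0.
pose b i : 'rV[R]_m.+1 := if sel i is Some p then dyadic_upper p.1 p.2 else 0.
have abP i x : box (a i) (b i) x -> exists2 p, sel i = Some p & dyadic p.1 p.2 x.
  rewrite /a /b; case: (sel i) => [p|]; first by exists p.
  by move=> /(_ ord0); rewrite !mxE in_itv /= => /andP[/lt_le_trans h /h]; rewrite ltxx.
exists a, b; split.
- move=> i j; rewrite /a /b; case: (sel i) => [p|//].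
  by rewrite !mxE ler_pM2r ?invr_gt0 ?exprn_gt0// ler_int gerBl.
- apply/seteqP; split => [x Ox|x [i _ /abP[p /selP[[pO _] _] px]]]; last exact: pO.
  have [p pO px] := maximal_dyadic_cover oO Ox.
  exists (pickle p) => //.
  have e : sel (pickle p) = Some p.
    by rewrite /sel pickleK_inv; case: asboolP.
  by rewrite /a /b e.
- apply/trivIsetP => i i' _ _ /eqP ii'.
  apply/seteqP; split => // x [/abP[p /selP[pO pi] px] /abP[p' /selP[pO' pi'] px']].
  by apply: ii'; rewrite -pi -pi' (maximal_dyadic_inj pO pO' px px').
Qed.

Lemma open_measurable_rV (R : realType) (m : nat) (O : set 'rV[R]_m.+1) :
  open O -> measurable O.
Proof.
move=> /open_boxes[a [b [_ -> _]]].
by apply: bigcupT_measurable => i; exact: measurable_box.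
Qed.

Section outer_upper_bound.
Local Open Scope ereal_scope.
Context {R : realType}.

Lemma nneseries_interleave_le (u v : nat -> \bar R) :
  (forall n, 0 <= u n) -> (forall n, 0 <= v n) ->
  \sum_(0 <= n <oo) (if odd n then v n./2 else u n./2) <=
  \sum_(0 <= n <oo) u n + \sum_(0 <= n <oo) v n.
Proof.
move=> u0 v0; pose w n := if odd n then v n./2 else u n./2.
have w0 n : 0 <= w n by rewrite /w; case: ifP.
rewrite [X in X <= _](_ : _ = \sum_(0 <= n <oo) w n)//.
apply: lime_le; first exact: is_cvg_nneseries.
near=> n.
apply: (@le_trans _ _ (\sum_(0 <= i < n.*2) w i)).
  apply: lee_sum_nneg_natr => //; first by rewrite -addnn leq_addr.
have -> : \sum_(0 <= i < n.*2) w i = \sum_(0 <= i < n) u i + \sum_(0 <= i < n) v i.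
  elim: (n : nat) => [|k IH]; first by rewrite !big_geq// adde0.
  rewrite doubleS !big_nat_recr//= IH /w /= odd_double /= uphalf_double.
  by rewrite doubleK addeACA addeA.
by apply: leeD; exact: nneseries_lim_ge.
Unshelve. all: by end_near. Qed.

(** The dyadic tiling of [O] is an exact cover, and it is completed by a cover
    of [Z] of arbitrarily small total volume. *)
Lemma lebesgue_outer_le_open (m : nat) (A O Z : set 'rV[R]_m.+1) :
  open O -> lebesgue_outer Z = 0 -> A `<=` O `|` Z ->
  lebesgue_outer A <= leb_rV R m.+1 O.
Proof.
move=> oO Z0 AOZ.
have [a [b [ab Oab tab]]] := open_boxes oO.
have -> : leb_rV R m.+1 O = \sum_(0 <= n <oo) (\prod_j (b n 0 j - a n 0 j))%:E.
  rewrite Oab measure_semi_bigcup//.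
  - by apply: eq_eseriesr => n _; exact: (leb_rV_box (ab n)).
  - by move=> n; exact: measurable_box.
  - by rewrite -Oab; exact: open_measurable_rV.
apply/lee_addgt0Pr => e e0.
have : lebesgue_outer Z < e%:E by rewrite Z0 lte_fin.
move=> /ereal_inf_lt[_ [a' [b' [ab' Zab' ->]]]] /ltW le_e.
apply: le_trans (leeD2l _ le_e).
apply: le_trans (nneseries_interleave_le _ _); last 2 first.
- by move=> n; rewrite lee_fin prodr_ge0// => j _; rewrite subr_ge0.
- by move=> n; rewrite lee_fin prodr_ge0// => j _; rewrite subr_ge0.
apply: ereal_inf_lbound.
(* The two covers are enumerated alternately. *)
exists (fun n => if odd n then a' n./2 else a n./2),
  (fun n => if odd n then b' n./2 else b n./2); split.
- by move=> n j; case: ifP.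
- move=> x /AOZ[|/Zab'[n _ h]].
    rewrite Oab => -[n _ h]; exists n.*2 => //.
    by rewrite odd_double doubleK.
  by exists n.*2.+1 => //=; rewrite odd_double uphalf_double.
- by apply: eq_eseriesr => n _; case: ifP.
Qed.

End outer_upper_bound.

(** * Linear changes of variables *)

Lemma continuous_rV (R : realType) (T : topologicalType) (m : nat)
    (f : T -> 'rV[R]_m) :
  (forall j, continuous (fun x => f x 0 j)) -> continuous f.
Proof.
move=> cf x A [Q nQ QA]; rewrite /= nbhs_filterE.
have : \forall y \near x, forall j, Q 0 j (f y 0 j).
  by apply: filter_forall => j; apply: cf; exact: nQ.
by apply: filterS => y h; apply: QA => i j; rewrite (ord1 i).
Qed.

Lemma continuous_mulmxr (R : realType) (m n : nat) (P : 'M[R]_(m, n)) :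
  continuous (fun x : 'rV[R]_m => x *m P).
Proof.
apply: continuous_rV => j; under eq_fun do rewrite mxE.
apply: continuous_big => [|i _ x]; first exact: add_continuous.
apply: (@continuousM R 'rV[R]_m (fun y => y 0 i) (fun=> P i j)).
  exact: coord_continuous.
exact: cst_continuous.
Qed.

Section leb_rV_bounds.
Context {R : realType}.
Local Open Scope ereal_scope.

Lemma leb_rV_open_gt0 (m : nat) (O : set 'rV[R]_m.+1) :
  open O -> O !=set0 -> 0 < leb_rV R m.+1 O.
Proof.
move=> oO [x Ox]; have [n nO] := open_dyadic oO Ox.
set k := dyadic_index n x in nO.
have n2 : (0 < 2 ^+ n :> R)%R by rewrite exprn_gt0.
have lt_lu j : (dyadic_lower n k 0 j < dyadic_upper n k 0 j :> R)%R.
  by rewrite !mxE ltr_pM2r ?invr_gt0// ltr_int gtrBl.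
apply: (@lt_le_trans _ _ (leb_rV R m.+1 (dyadic n k))).
  rewrite (leb_rV_box (fun j => ltW (lt_lu j))) lte_fin prodr_gt0// => j _.
  by rewrite subr_gt0.
apply: le_measure nO; rewrite inE; first exact: measurable_box.
exact: open_measurable_rV.
Qed.

Lemma leb_rV_bounded_lty (m : nat) (A : set 'rV[R]_m) (M : R) :
  measurable A -> (forall x j, A x -> (`|x 0 j| <= M)%R) ->
  leb_rV R m A < +oo.
Proof.
move=> mA AM.
pose b : 'rV[R]_m := const_mx (`|M| + 1)%R.
have b0 j : ((- b) 0 j <= b 0 j)%R.
  by rewrite !mxE; have := normr_ge0 M; lra.
apply: (@le_lt_trans _ _ (leb_rV R m (box (- b) b))); last first.
  by rewrite (leb_rV_box b0) ltry.
apply: le_measure; rewrite ?inE //; first exact: measurable_box.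
move=> x Ax j; rewrite !mxE in_itv /=.
have := AM x j Ax; rewrite ler_norml; have := ler_norm M; lra.
Qed.

Lemma normr_mulmx_le (m n : nat) (P : 'M[R]_(m, n)) (x : 'rV[R]_m) j :
  (forall i, (`|x 0 i| <= 1)%R) -> (`|(x *m P) 0 j| <= \sum_i `|P i j|)%R.
Proof.
move=> x1; rewrite mxE; apply: le_trans (ler_norm_sum _ _ _) _.
by apply: ler_sum => i _; rewrite normrM ler_piMl.
Qed.

End leb_rV_bounds.

Section linear_substitution.
Local Open Scope ereal_scope.
Context {R : realType} {m : nat}.
Local Notation mu := (leb_rV R m).
Implicit Types f g : 'rV[R]_m -> \bar R.

(** The argument for the uniqueness of Haar measure, for the Lebesgue measure
    and its image under [P]: in the double integral of f(x) g(yP), replace x by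
    x + yP, then y by y - x P^-1, then x by x + yP. *)
Lemma haar_exchange (P : 'M[R]_m) f g : P \in unitmx ->
  measurable_fun setT f -> measurable_fun setT g ->
  (forall x, 0 <= f x) -> (forall x, 0 <= g x) ->
  \int[mu]_x f x * \int[mu]_y g (y *m P) =
  \int[mu]_y f (y *m P) * \int[mu]_x g (- x)%R.
Proof.
move=> uP mf mg f0 g0.
have mmul d (T : measurableType d) (h : T -> 'rV[R]_m) : measurable_fun setT h ->
    measurable_fun setT (fun t => h t *m P).
  by move=> mh; apply: (measurableT_comp (measurable_mulmxr P) mh).
have mopp d (T : measurableType d) (h : T -> 'rV[R]_m) : measurable_fun setT h ->
    measurable_fun setT (fun t => - h t)%R.
  move=> mh; apply: measurable_fun_rV => j; under eq_fun do rewrite mxE.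
  by apply: measurableT_comp => //; exact: (measurableT_comp (measurable_coord j) mh).
have mcomp (k : 'rV[R]_m -> \bar R) d (T : measurableType d) (h : T -> 'rV[R]_m) :
    measurable_fun setT k -> measurable_fun setT h ->
    measurable_fun setT (fun t => k (h t)).
  by move=> ? ?; exact: measurableT_comp.
transitivity (\int[mu]_y \int[mu]_x (f (x + y *m P)%R * g (y *m P))).
  rewrite muleC -ge0_integralZr//; first last.
  - by apply: integral_ge0.
  - by apply: mcomp => //; exact: mmul.
  apply: eq_integral => y _.
  rewrite ge0_integralZr//; last by apply: mcomp => //; exact: measurable_fun_addrV.
  by rewrite (leb_rV_translation _ mf f0) muleC.
rewrite (@fubini_tonelli _ _ _ _ R mu mu
  (fun p => f (p.2 + p.1 *m P)%R * g (p.1 *m P))); first last.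
- by move=> p; rewrite mule_ge0.
- apply: emeasurable_funM; apply: mcomp => //.
    by apply: measurable_fun_addrV => //; exact: mmul.
  exact: mmul.
transitivity (\int[mu]_x \int[mu]_y (f (y *m P) * g (y *m P - x)%R)).
  apply: eq_integral => x _ /=.
  rewrite -(@leb_rV_translation _ _ (- (x *m invmx P))%R); first last.
  - by move=> y; rewrite mule_ge0.
  - apply: emeasurable_funM; apply: mcomp => //; last exact: mmul.
    by apply: measurable_fun_addrV => //; exact: mmul.
  apply: eq_integral => y _.
  by rewrite mulmxDl mulNmx mulmxKV// addrC subrK.
rewrite -(@fubini_tonelli _ _ _ _ R mu mu
  (fun p => f (p.1 *m P)%R * g (p.1 *m P - p.2)%R)); first last.
- by move=> p; rewrite mule_ge0.
- apply: emeasurable_funM; apply: mcomp => //; first exact: mmul.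
  by apply: measurable_fun_addrV => //; [exact: mmul|exact: mopp].
rewrite -ge0_integralZr//; first last.
- by apply: integral_ge0.
- by apply: mcomp => //; exact: mmul.
apply: eq_integral => y _ /=.
rewrite ge0_integralZl//; last first.
  by apply: mcomp => //; apply: measurable_fun_addrV => //; exact: mopp.
congr (_ * _).
rewrite -(@leb_rV_translation _ _ (y *m P)%R) //; last first.
  by apply: mcomp => //; apply: measurable_fun_addrV => //; exact: mopp.
by apply: eq_integral => x _; rewrite opprD addrCA subrr addr0.
Qed.

End linear_substitution.

(** The constant is the inverse of the absolute value of the determinant of
    [P], but any positive value will do.  It is obtained from [haar_exchange]
    with g the indicator of the open cube [S] = ]-1, 1[^m, which is symmetric. *)
Lemma ge0_integral_linear (R : realType) (m : nat) (P : 'M[R]_m.+1) :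
  P \in unitmx -> exists2 c : R, 0 < c &
    forall f : 'rV[R]_m.+1 -> \bar R, measurable_fun setT f -> (forall x, 0 <= f x)%E ->
    (\int[leb_rV R m.+1]_y f (y *m P) = c%:E * \int[leb_rV R m.+1]_x f x)%E.
Proof.
move=> uP.
pose S : set 'rV[R]_m.+1 := ball 0 1.
have oS : open S by exact: ball_open.
have mS : measurable S by exact: open_measurable_rV.
have S1 x j : S x -> `|x 0 j| <= 1.
  by move=> [_ /(_ 0 j)]; rewrite /ball /= !mxE sub0r normrN => /ltW.
have S0 : S 0 by exact: ballxx.
pose g (x : 'rV[R]_m.+1) := (\1_S x)%:E : \bar R.
have g0 x : (0 <= g x)%E by rewrite lee_fin.
have mg : measurable_fun setT g by exact/measurable_EFinP/measurable_indic.
have SN x : (- x \in S) = (x \in S).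
  apply/idP/idP; rewrite !inE => -[_ h]; split => // i j; have := h i j.
    by rewrite /ball /= !mxE !sub0r opprK normrN.
  by rewrite /ball /= !mxE !sub0r opprK normrN.
have int_g : (\int[leb_rV R m.+1]_x g (- x)%R = leb_rV R m.+1 S)%E.
  transitivity (\int[leb_rV R m.+1]_x (\1_S x)%:E)%E.
    by apply: eq_integral => x _; rewrite /g /indic SN.
  exact: integral_indicT.
pose T := (fun x : 'rV[R]_m.+1 => x *m P) @^-1` S.
have oT : open T.
  by apply: open_comp oS => x _; exact: continuous_mulmxr.
have mT : measurable T by exact: open_measurable_rV.
have int_gP : (\int[leb_rV R m.+1]_x g (x *m P) = leb_rV R m.+1 T)%E.
  transitivity (\int[leb_rV R m.+1]_x (\1_T x)%:E)%E; first by [].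
  exact: integral_indicT.
have [s s0 sE] : exists2 s : R, 0 < s & leb_rV R m.+1 S = s%:E.
  have Sgt0 := leb_rV_open_gt0 oS (ex_intro _ _ S0).
  have Slty := leb_rV_bounded_lty mS S1.
  exact: pos_lty_EFin.
have [t t0 tE] : exists2 t : R, 0 < t & leb_rV R m.+1 T = t%:E.
  have Tgt0 : (0 < leb_rV R m.+1 T)%E.
    by apply: leb_rV_open_gt0 => //; exists 0; rewrite /T /= mul0mx.
  have Tlty : (leb_rV R m.+1 T < +oo)%E.
    apply: (@leb_rV_bounded_lty _ _ _ (\sum_i \sum_j `|invmx P i j|)) => // x j Tx.
    rewrite -[x](mulmxK uP).
    apply: le_trans (normr_mulmx_le _ _ _) _; first by move=> i; exact: S1.
    apply: ler_sum => i _.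
    by rewrite (bigD1 j)//= lerDl sumr_ge0.
  exact: pos_lty_EFin.
exists (t / s); first by rewrite divr_gt0.
move=> f mf f0.
have := haar_exchange uP mf mg f0 g0.
rewrite int_g int_gP sE tE => h.
rewrite EFinM muleAC [(t%:E * _)%E]muleC h -muleA -EFinM divff ?gt_eqF//.
by rewrite mule1.
Qed.

(** * Integrals along lines *)

Section arcsine_density.
Context {R : realType}.
Local Notation mu := (@lebesgue_measure R).
Implicit Types s t rho a : R.

Lemma measurable_inv_sqrt : measurable_fun [set: R] (fun u : R => (Num.sqrt u)^-1).
Proof.
have ms : measurable_fun [set: R] (@Num.sqrt R).
  by apply: continuous_measurable_fun; exact: sqrt_continuous.
rewrite (_ : (fun u => _) = (@powR R ^~ (-1)) \o @Num.sqrt R).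
  exact: measurableT_comp.
by apply/funext => u /=; rewrite powR_inv1 ?sqrtr_ge0.
Qed.

(** Outside ]-1, 1[ the square root is taken at a nonpositive number, hence is
    0, and so is its inverse: the density vanishes there. *)
Definition arcsine_density (s : R) : R := (Num.sqrt (1 - s ^+ 2))^-1.

Lemma arcsine_density_ge0 s : 0 <= arcsine_density s.
Proof. by rewrite invr_ge0 sqrtr_ge0. Qed.

Lemma measurable_arcsine_density : measurable_fun [set: R] arcsine_density.
Proof.
apply: (measurableT_comp measurable_inv_sqrt).
by apply: measurable_funB => //; exact: exprn_measurable.
Qed.

Lemma arcsine_density_out s : 1 <= `|s| -> arcsine_density s = 0.
Proof.
move=> s1; rewrite /arcsine_density ler0_sqrtr ?invr0// subr_le0.
by rewrite -real_normK ?num_real// exprn_ege1.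
Qed.

Definition arcsine_mass : \bar R := (\int[mu]_s (arcsine_density s)%:E)%E.

Lemma arcsine_mass_gt0 : (0 < arcsine_mass)%E.
Proof.
apply: (@lt_le_trans _ _ (\int[mu]_s (\1_(`]-1, 1[ : set R) s)%:E)%E).
  have -> : (\int[mu]_s (\1_(`]-1, 1[ : set R) s)%:E = mu `](-1)%R, 1%R[)%E.
    exact: integral_indicT.
  by rewrite lebesgue_measure_itv /= lte_fin gtrN// -EFinD lte_fin; lra.
apply: ge0_le_integral => //.
- exact/measurable_EFinP/measurable_indic.
- by apply/measurable_EFinP; exact: measurable_arcsine_density.
move=> s _; rewrite lee_fin indicE; case: (boolP (s \in _)) => [|_].
  rewrite inE /= in_itv /= => /andP[s1 s2].
  have h : 0 < 1 - s ^+ 2 by nra.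
  rewrite invf_ge1 ?sqrtr_gt0// -[leRHS]sqrtr1 ler_sqrt//.
  by rewrite gerBl sqr_ge0.
exact: arcsine_density_ge0.
Qed.

(** [asin] is a primitive of the density. *)
Lemma arcsine_mass_segment (c : R) : 0 < c < 1 ->
  (\int[mu]_(s in `[(- c)%R, c%R]) (arcsine_density s)%:E <= pi%:E)%E.
Proof.
move=> /andP[c0 c1].
have in1 x : x \in `[- c, c] -> -1 < x < 1.
  by rewrite in_itv /= => /andP[x1 x2]; apply/andP; split; lra.
have asinc x : x \in `[- c, c] -> {for x, continuous (@asin R)}.
  by move=> /in1; exact: continuous_asin.
rewrite (@continuous_FTC2 _ _ (@asin R)); first last.
- move=> x xc; rewrite derive1E.
  have /in1 x1 : x \in `[- c, c] by exact: subset_itv_oo_cc xc.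
  exact: (@derive_val _ _ _ _ _ _ _ (is_derive1_asin x1)).
- split.
  + move=> x xc; have /in1 x1 : x \in `[- c, c] by exact: subset_itv_oo_cc xc.
    exact: (@ex_derive _ _ _ _ _ _ _ (is_derive1_asin x1)).
  + by apply/cvg_at_right_filter/asinc; rewrite in_itv /= lexx; lra.
  + by apply/cvg_at_left_filter/asinc; rewrite in_itv /= lexx andbT; lra.
- apply: continuous_in_subspaceT => x; rewrite inE /= => /in1 /andP[x1 x2].
  have h : 0 < 1 - x ^+ 2 by nra.
  apply: (@cvgV _ _ _ _ (fun x : R => Num.sqrt (1 - x ^+ 2))); first by rewrite gt_eqF// sqrtr_gt0.
  apply: (@continuous_comp _ _ _ (fun x : R => 1 - x ^+ 2) (@Num.sqrt R)).
    apply: continuousB; first exact: cst_continuous.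
    exact: exprn_continuous.
  exact: sqrt_continuous.
- by lra.
rewrite -EFinB lee_fin.
have : asin c <= pi / 2 by apply: asin_lepi2; lra.
have : - (pi / 2) <= asin (- c) by apply: asin_geNpi2; lra.
lra.
Qed.

(** The primitive is not differentiable at the end points, whence the exhaustion
    of ]-1, 1[ by segments. *)
Lemma arcsine_mass_lty : (arcsine_mass < +oo)%E.
Proof.
apply: (@le_lt_trans _ _ (pi%:E : \bar R)); last by rewrite ltry.
pose c (n : nat) : R := 1 - n.+2%:R^-1.
pose F (n : nat) : set R := `[- c n, c n]%classic.
have c01 n : 0 < c n < 1.
  rewrite /c subr_gt0 gtrBl invr_gt0 ltr0n andbT.
  by rewrite invf_lt1 ?ltr0n// ltr1n.
have mf : measurable_fun setT (EFin \o arcsine_density).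
  by apply/measurable_EFinP; exact: measurable_arcsine_density.
have ndF : nondecreasing_seq F.
  apply/nondecreasing_seqP => n; rewrite subsetEset => x; rewrite /F /= !in_itv /=.
  have : c n <= c n.+1 by rewrite lerB// lef_pV2 ?posrE ?ltr0n// ler_nat.
  by move=> h /andP[? ?]; apply/andP; split; lra.
have := @ge0_nondecreasing_set_cvg_integral _ (measurableTypeR R) _ F (EFin \o arcsine_density) mu ndF
  (fun n => measurable_itv _) (fun n => measurable_funS measurableT (@subsetT _ _) mf)
  (fun n x _ => arcsine_density_ge0 x).
have UF : \bigcup_n F n = `]-1, 1[%classic.
  apply/seteqP; split => x; rewrite /F /= in_itv /=.
    move=> [n _ /=]; rewrite in_itv /= => /andP[? ?].
    by have /andP[? ?] := c01 n; apply/andP; split; lra.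
  move=> /andP[x1 x2].
  have x0 : 0 < 1 - `|x| by rewrite subr_gt0 ltr_norml x1.
  exists (Num.trunc (1 - `|x|)^-1) => //=.
  set n := Num.trunc _.
  have h : n.+2%:R^-1 <= 1 - `|x|.
    rewrite -[leRHS]invrK lef_pV2 ?posrE ?invr_gt0 ?ltr0n//.
    by apply/ltW/(lt_trans (truncnS_gt _)); rewrite ltr_nat.
  by rewrite in_itv /= -ler_norml /c lerBrDl -lerBrDr.
rewrite UF (_ : (\int[mu]_(x in `](-1)%R, 1%R[) _)%E = arcsine_mass) => [cv|]; last first.
  rewrite integral_mkcond; apply: eq_integral => x _.
  rewrite patchE; case: ifPn => // /negP xn; congr EFin.
  apply/esym/arcsine_density_out; rewrite leNgt; apply/negP => x1; apply: xn.
  by rewrite inE /= in_itv /= -ltr_norml.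
rewrite -(cvg_lim _ cv)//; apply: lime_le; first by apply/cvg_ex; eexists; exact: cv.
by near=> n; exact: arcsine_mass_segment.
Unshelve. all: by end_near. Qed.

(** The substitution of sqrt (a / rho) (t + s) for the variable produces a
    factor sqrt (rho / a), whose dependence on [rho] is compensated by the
    factor 1 / sqrt rho that comes out of the density.  Thus neither the depth
    [rho] at which a line enters the ellipsoid nor the location [- s] of its
    deepest point matters. *)
Lemma arcsine_mass_chord (rho a s : R) : 0 < a -> 0 < rho ->
  (\int[mu]_t ((Num.sqrt (rho - a * (t + s) ^+ 2))^-1)%:E =
   (Num.sqrt a)^-1%:E * arcsine_mass)%E.
Proof.
move=> a0 r0.
pose k := Num.sqrt (a / rho).
have k0 : 0 < k by rewrite sqrtr_gt0 divr_gt0.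
have kE : k ^+ 2 = a / rho by rewrite sqr_sqrtr// divr_ge0// ltW.
rewrite /arcsine_mass (@ge0_integral_affine _ k (k * s) k0 (EFin \o arcsine_density)); first last.
- by move=> t; rewrite lee_fin arcsine_density_ge0.
- by apply/measurable_EFinP; exact: measurable_arcsine_density.
rewrite muleA -EFinM.
have mk : measurable_fun setT (fun t : R => (arcsine_density (k * t + k * s))%:E).
  apply/measurable_EFinP; apply: (measurableT_comp measurable_arcsine_density).
  by apply: measurable_funD => //; exact: measurable_funM.
rewrite -ge0_integralZl_EFin//; first last.
- by rewrite mulr_ge0// ?invr_ge0 ?sqrtr_ge0// ltW.
- by move=> t _; rewrite lee_fin arcsine_density_ge0.
apply: eq_integral => t _; rewrite -EFinM; congr EFin.
have -> : rho - a * (t + s) ^+ 2 = rho * (1 - (k * t + k * s) ^+ 2).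
  by rewrite -mulrDr exprMn kE; field; rewrite gt_eqF.
rewrite sqrtrM ?ltW// invfM; congr (_ * _).
rewrite /k sqrtrM ?ltW// sqrtrV ?ltW// mulrA mulVf ?mul1r//.
by rewrite gt_eqF// sqrtr_gt0.
Qed.

End arcsine_density.

(** * Orthonormal frames adapted to a cylinder *)

Section dot_theory.
Context {R : realType} {m : nat}.
Implicit Types x y z : 'rV[R]_m.

Lemma dotE x y : dot x y = \sum_j x 0 j * y 0 j.
Proof. by rewrite /dot mxE; apply: eq_bigr => j _; rewrite mxE. Qed.

Lemma dotC x y : dot x y = dot y x.
Proof. by rewrite !dotE; apply: eq_bigr => j _; rewrite mulrC. Qed.

Lemma dotDl x y z : dot (x + y) z = dot x z + dot y z.
Proof. by rewrite /dot mulmxDl mxE. Qed.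

Lemma dotZl a x y : dot (a *: x) y = a * dot x y.
Proof. by rewrite /dot -scalemxAl mxE. Qed.

Lemma dotDr x y z : dot x (y + z) = dot x y + dot x z.
Proof. by rewrite dotC dotDl !(dotC x). Qed.

Lemma dotZr a x y : dot x (a *: y) = a * dot x y.
Proof. by rewrite dotC dotZl dotC. Qed.

Lemma dot_mx x y : x *m y^T = (dot x y)%:M.
Proof. by rewrite [LHS]mx11_scalar. Qed.

Lemma dot_ge0 x : 0 <= dot x x.
Proof. by rewrite dotE sumr_ge0// => j _; rewrite -expr2 sqr_ge0. Qed.

Lemma dot_eq0 x : dot x x = 0 -> x = 0.
Proof.
rewrite dotE => /eqP; rewrite psumr_eq0; last first.
  by move=> j _; rewrite -expr2 sqr_ge0.
move=> /allP h; apply/rowP => j; rewrite mxE.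
by have /h := mem_index_enum j; rewrite /= -expr2 sqrf_eq0 => /eqP.
Qed.

Lemma dot_gt0 x : x != 0 -> 0 < dot x x.
Proof.
rewrite lt_def dot_ge0 andbT; apply: contra => /eqP h; apply/eqP; exact: dot_eq0.
Qed.

Lemma normr_coord_le1 x j : dot x x <= 1 -> `|x 0 j| <= 1.
Proof.
move=> x1; rewrite -(@expr_le1 _ 2)// real_normK ?num_real//.
apply: le_trans x1; rewrite dotE (bigD1 j)//= -expr2 lerDl sumr_ge0// => k _.
by rewrite -expr2 sqr_ge0.
Qed.

End dot_theory.

(** The reflection in the hyperplane orthogonal to [u - e], which exchanges two
    vectors of the same length. *)
Lemma householder (R : realType) (m : nat) (e u : 'rV[R]_m) :
  dot e e = 1 -> dot u u = 1 -> exists2 S : 'M[R]_m, S *m S^T = 1%:M & e *m S = u.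
Proof.
move=> e1 u1; have [->|ue] := eqVneq u e.
  by exists 1%:M; rewrite ?trmx1 mulmx1.
pose v := u - e; pose b := dot v v.
have b0 : b != 0 by rewrite gt_eqF// dot_gt0// subr_eq0.
have bE : b = 2 - 2 * dot u e.
  by rewrite /b /v -scaleN1r !(dotDl, dotDr, dotZl, dotZr) e1 u1 (dotC e); ring.
have evE : dot e v = - (b / 2).
  by rewrite bE /v -scaleN1r !(dotDr, dotZr) e1 (dotC e); field.
have sym : (1%:M - (2 / b) *: (v^T *m v))^T = 1%:M - (2 / b) *: (v^T *m v).
  by rewrite linearB linearZ /= trmx1 trmx_mul trmxK.
exists (1%:M - (2 / b) *: (v^T *m v)).
  have VV : v^T *m v *m (v^T *m v) = b *: (v^T *m v).
    by rewrite -mulmxA (mulmxA v) dot_mx mul_scalar_mx -scalemxAr.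
  rewrite sym mulmxBr mulmx1 mulmxBl mul1mx -scalemxAl -scalemxAr VV !scalerA.
  have -> : 2 / b * (2 / b) * b = 2 / b + 2 / b by field.
  by rewrite scalerDl opprB addrK subrK.
rewrite mulmxBr mulmx1 -scalemxAr mulmxA dot_mx mul_scalar_mx scalerA evE.
have -> : 2 / b * - (b / 2) = -1 :> R by field.
by rewrite scaleN1r opprK /v addrC subrK.
Qed.

Section hyperplane_basis.
Context {R : realType} {m : nat}.

(** An orthogonal matrix whose first row is [h] has the sought basis as its
    other rows. *)
Lemma hyperplane_basis (h : 'rV[R]_(1 + m)) : dot h h = 1 ->
  exists Q : 'M[R]_(m, 1 + m),
    orthonormal_basis (orth [set t *: h | t in [set: R]]) Q.
Proof.
move=> h1; pose e : 'rV[R]_(1 + m) := row_mx 1%:M 0.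
have e1 : dot e e = 1.
  by rewrite /dot tr_row_mx mul_row_col trmx1 mulmx1 trmx0 mulmx0 addr0 mxE eqxx.
have [S SS eS] := householder e1 h1.
have SE : S = col_mx h (dsubmx S).
  rewrite -[LHS]vsubmxK; congr col_mx.
  by rewrite -eS -{2}[S]vsubmxK mul_row_col mul1mx mul0mx addr0.
exists (dsubmx S).
have : block_mx (h *m h^T) (h *m (dsubmx S)^T) (dsubmx S *m h^T)
    (dsubmx S *m (dsubmx S)^T) = block_mx 1%:M 0 0 1%:M.
  by rewrite -mul_col_row -tr_col_mx -SE SS scalar_mx_block.
move=> /eq_block_mx[_ _ Qh QQ]; split => //.
apply/seteqP; split => [x xh|_ [y _ <-] _ [t _ <-]]; last first.
  by rewrite dotZr /dot -mulmxA Qh mulmx0 mxE mulr0.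
exists (x *m (dsubmx S)^T) => //.
have := mulmx1C SS; rewrite {1 2}SE tr_col_mx mul_row_col => STS.
rewrite -[RHS]mulmx1 -STS mulmxDr !mulmxA dot_mx.
rewrite (_ : dot x h = 0) ?raddf0 ?mul0mx ?add0r//.
by apply: xh; exists 1; rewrite ?scale1r.
Qed.

End hyperplane_basis.

Section frames.
Context {R : realType} {m : nat}.
Implicit Types (h : 'rV[R]_(1 + m)) (Q : 'M[R]_(m, 1 + m)).

(** [h] spans the axis of a cylinder and the rows of [Q] are an orthonormal
    basis of its orthogonal hyperplane. *)
Definition frame h Q : Prop := [/\ dot h h = 1, h *m Q^T = 0 & Q *m Q^T = 1%:M].

Variables (h : 'rV[R]_(1 + m)) (Q : 'M[R]_(m, 1 + m)).
Hypothesis fhQ : frame h Q.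
Local Notation E := (orth [set t *: h | t in [set: R]]).

Lemma frame_QhT : Q *m h^T = 0.
Proof. by have [_ hQ _] := fhQ; rewrite -[LHS]trmxK trmx_mul trmxK hQ trmx0. Qed.

Lemma frame_mulmxT : col_mx h Q *m (col_mx h Q)^T = 1%:M.
Proof.
have [h1 hQ QQ] := fhQ.
rewrite tr_col_mx mul_col_row dot_mx h1 hQ frame_QhT QQ.
by rewrite -scalar_mx_block.
Qed.

Lemma frame_unitmx : col_mx h Q \in unitmx.
Proof. by have [] := mulmx1_unit frame_mulmxT. Qed.

Lemma rV_cons_frame y t : rV_cons (y, t) *m col_mx h Q = t *: h + y *m Q.
Proof. by rewrite /rV_cons mul_row_col mul_scalar_mx. Qed.

Lemma frame_coord t y : (t *: h + y *m Q) *m Q^T = y.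
Proof.
have [h1 hQ QQ] := fhQ.
by rewrite mulmxDl -scalemxAl hQ scaler0 add0r -mulmxA QQ mulmx1.
Qed.

(** [x *m Q^T] are the coordinates of the projection of [x] along [h]. *)
Lemma frame_decomp (x : 'rV[R]_(1 + m)) : x = dot x h *: h + x *m Q^T *m Q.
Proof.
have := mulmx1C frame_mulmxT; rewrite tr_col_mx mul_row_col => PP.
by rewrite -{1}[x]mulmx1 -PP mulmxDr !mulmxA dot_mx mul_scalar_mx.
Qed.

Lemma orth_frame y : E (y *m Q).
Proof.
by move=> _ [t _ <-]; rewrite dotZr /dot -mulmxA frame_QhT mulmx0 mxE mulr0.
Qed.

Lemma orth_projP K y :
  orth_proj E K (y *m Q) <-> exists t, K (t *: h + y *m Q).
Proof.
have [h1 hQ QQ] := fhQ; split=> [[_ [x Kx xy]]|[t Kt]].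
  have w0 : (x - y *m Q) *m Q^T = 0.
    apply: dot_eq0; rewrite {1}/dot -mulmxA -trmx_mul.
    exact: (xy _ (orth_frame _)).
  have xQ : x *m Q^T = y.
    by apply/eqP; rewrite -subr_eq0 -w0 mulmxBl -[y *m Q *m _]mulmxA QQ mulmx1.
  by exists (dot x h); rewrite -xQ -frame_decomp.
split; first exact: orth_frame.
exists (t *: h + y *m Q) => //; rewrite addrK => z Ez.
by rewrite dotC; apply: Ez; exists t.
Qed.

Lemma coords_relint (B : set 'rV[R]_(1 + m)) :
  [set y | relint E B (y *m Q)] `<=` [set y | B (y *m Q)]°.
Proof.
move=> y [_ By]; rewrite /interior /=.
have /= := @continuous_mulmxr _ _ _ Q y _ By.
by rewrite nbhs_filterE; apply: (@filterS _ (nbhs y)) => z; apply; exact: orth_frame.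
Qed.

End frames.

Lemma cyl_dir_line (R : realType) (d : nat) (C : cylinder R d 1) :
  exists2 h : 'rV[R]_d, dot h h = 1 & [set` cyl_dir C] = [set t *: h | t in [set: R]].
Proof.
have dimH := cyl_dimv C; set H := cyl_dir C in dimH *.
pose v := vpick H.
have v0 : v != 0 by rewrite vpick0 -dimv_eq0 dimH.
have HE : H = <[v]>%VS.
  apply/esym/eqP; rewrite eqEdim -memvE memv_pick /= dimH dim_vline.
  by rewrite v0.
have vv := dot_gt0 v0; pose n := Num.sqrt (dot v v).
have n0 : n != 0 by rewrite gt_eqF// sqrtr_gt0.
exists (n^-1 *: v).
  rewrite dotZl dotZr mulrA -expr2 exprVn sqr_sqrtr ?ltW// mulVf//.
  by rewrite gt_eqF.
apply/seteqP; split => [x /=|_ [t _ <-] /=]; rewrite HE.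
  move=> /vlineP[k ->]; exists (k * n) => //.
  by rewrite scalerA -mulrA divff// mulr1.
by rewrite memvZ// memvZ// memv_line.
Qed.

Section cylinder_coords.
Context {R : realType} {m : nat}.
Variable C : cylinder R (1 + m) 1.

(** [coords] reads bases through a basis chosen by [xget], which is meaningful
    because the hyperplane has an orthonormal basis. *)
Lemma coords_frame : exists2 h : 'rV[R]_(1 + m),
    [set` cyl_dir C] = [set t *: h | t in [set: R]] &
    frame h (xget (0 : 'M[R]_(m, 1 + m)) [set Q | orthonormal_basis (cyl_orth C) Q]).
Proof.
have [h h1 HE] := cyl_dir_line C; exists h => //.
have [Q0 Q0E] := hyperplane_basis h1.
set Q := xget _ _.
have [QQ EQ] : orthonormal_basis (cyl_orth C) Q.
  by apply: xgetPex; exists Q0; rewrite /= /cyl_orth HE.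
split => //; apply: dot_eq0; rewrite {1}/dot -mulmxA -trmx_mul.
have : cyl_orth C (h *m Q^T *m Q) by rewrite EQ; exists (h *m Q^T).
rewrite /cyl_orth HE -/(dot h _) dotC; apply.
by exists 1; rewrite ?scale1r.
Qed.

End cylinder_coords.

(** * The density on an ellipsoid *)

Section ellipsoid_density.
Context {R : realType} {d : nat}.
Variables (A : 'M[R]_d) (c : 'rV[R]_d).
Hypothesis uA : A \in unitmx.

(** The squared norm for which the ellipsoid is the unit ball. *)
Definition gauge (x : 'rV[R]_d) : R :=
  dot ((x - c) *m invmx A) ((x - c) *m invmx A).

(** As for [arcsine_density], the value is 0 outside the ellipsoid. *)
Definition ell_density (x : 'rV[R]_d) : R := (Num.sqrt (1 - gauge x))^-1.

Lemma ellipsoid_gaugeE :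
  [set x *m A + c | x in [set x | dot x x <= 1]] = [set x | gauge x <= 1].
Proof.
apply/seteqP; split => [_ [x xx <-]|x qx] /=.
  by rewrite /gauge addrK mulmxK.
by exists ((x - c) *m invmx A) => //; rewrite mulmxKV// subrK.
Qed.

Lemma gauge_sumE x :
  gauge x = \sum_j ((x - c) *m invmx A) 0 j * ((x - c) *m invmx A) 0 j.
Proof. by rewrite /gauge dotE. Qed.

Lemma continuous_gauge : continuous gauge.
Proof.
have cB : continuous (fun x : 'rV[R]_d => x - c).
  by move=> x; apply: continuousB; [exact: cvg_id|exact: cst_continuous].
have cj j : continuous (fun x : 'rV[R]_d => ((x - c) *m invmx A) 0 j).
  move=> x.
  have cM := continuous_comp (cB x) (@continuous_mulmxr _ _ _ (invmx A) _).
  exact: (continuous_comp cM (@coord_continuous _ _ _ 0 j _)).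
rewrite (funext gauge_sumE).
apply: continuous_big => [|j _ x]; first exact: add_continuous.
exact: (continuousM (cj j x) (cj j x)).
Qed.

Lemma measurable_gauge : measurable_fun [set: 'rV[R]_d] gauge.
Proof.
rewrite (funext gauge_sumE).
have mj j : measurable_fun setT (fun x : 'rV[R]_d => ((x - c) *m invmx A) 0 j).
  apply: (measurableT_comp (measurable_coord j)).
  apply: (measurableT_comp (measurable_mulmxr (invmx A))).
  exact: measurable_fun_addrV.
by apply: measurable_sum => j; exact: measurable_funM.
Qed.

Lemma ell_density_ge0 x : 0 <= ell_density x.
Proof. by rewrite invr_ge0 sqrtr_ge0. Qed.

Lemma ell_density_out x : 1 <= gauge x -> ell_density x = 0.
Proof. by move=> q1; rewrite /ell_density ler0_sqrtr ?invr0// subr_le0. Qed.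

Lemma measurable_ell_density : measurable_fun [set: 'rV[R]_d] ell_density.
Proof.
apply: (measurableT_comp (@measurable_inv_sqrt R)).
by apply: measurable_funB => //; exact: measurable_gauge.
Qed.

Lemma open_gauge_lt1 : open [set x | gauge x < 1].
Proof.
apply: (@open_comp _ _ gauge [set u : R | u < 1]); last exact: open_lt.
by move=> x _; exact: continuous_gauge.
Qed.

Lemma gauge_contract (e : R) x : gauge (c + e *: (x - c)) = e ^+ 2 * gauge x.
Proof.
by rewrite /gauge addrAC subrr add0r -scalemxAl dotZl dotZr mulrA expr2.
Qed.

End ellipsoid_density.

Section ellipsoid_sections.
Context {R : realType} {n : nat}.
Local Notation m := n.+1.
Variables (A : 'M[R]_(1 + m)) (c : 'rV[R]_(1 + m)).
Hypothesis uA : A \in unitmx.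
Variables (h : 'rV[R]_(1 + m)) (Q : 'M[R]_(m, 1 + m)).
Hypothesis fhQ : frame h Q.
Local Notation q := (gauge A c).
Local Notation w := (ell_density A c).

(** The projection of the open ellipsoid along [h], in the coordinates of
    [Q]. *)
Definition shadow : set 'rV[R]_m := [set y | exists t, q (t *: h + y *m Q) < 1].

Let u := h *m invmx A.
Let a := dot u u.
Let z (y : 'rV[R]_m) := (y *m Q - c) *m invmx A.
Let s y := dot u (z y) / a.
Let rho y := 1 - dot (z y) (z y) + a * s y ^+ 2.

Let a_gt0 : 0 < a.
Proof.
apply: dot_gt0; apply/eqP => u0.
have h0 : h = 0 by rewrite -(mulmxKV uA h) -/u u0 mul0mx.
have [h1 _ _] := fhQ; move: h1; rewrite h0 /dot mul0mx mxE => /eqP.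
by rewrite eq_sym oner_eq0.
Qed.

(** Completion of the square; the leading coefficient [a] does not depend on
    the line [y], which is what makes [line_integral] constant on the shadow. *)
Let gauge_line y t : 1 - q (t *: h + y *m Q) = rho y - a * (t + s y) ^+ 2.
Proof.
rewrite /gauge -addrA mulmxDl -scalemxAl -/u -/(z y).
rewrite !(dotDl, dotDr, dotZl, dotZr) (dotC (z y) u) -/a /rho.
have -> : dot u (z y) = a * s y by rewrite /s mulrC divfK// gt_eqF.
ring.
Qed.

Let shadowP y : shadow y <-> 0 < rho y.
Proof.
split=> [[t]|r0].
  rewrite -subr_gt0 gauge_line subr_gt0; apply: le_lt_trans.
  by rewrite mulr_ge0 ?sqr_ge0// ltW.
by exists (- s y); rewrite -subr_gt0 gauge_line addNr expr0n mulr0 subr0.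
Qed.

Let line_integral y : shadow y ->
  (\int[lebesgue_measure]_t (w (t *: h + y *m Q))%:E =
   (Num.sqrt a)^-1%:E * arcsine_mass)%E.
Proof.
move=> /shadowP r0; rewrite -(arcsine_mass_chord (s y) a_gt0 r0).
by apply: eq_integral => t _; rewrite /ell_density gauge_line.
Qed.

(** The projection of [w dx] along [h] is, up to a constant, Lebesgue measure
    on the shadow: the integral over each line is constant, and passing to the
    coordinates of the frame costs a constant factor. *)
Lemma ell_density_projection : exists2 e : R, 0 < e &
  forall O : set 'rV[R]_m, measurable O -> O `<=` shadow ->
  (\int[leb_rV R (1 + m)]_x (w x * \1_O (x *m Q^T))%:E = e%:E * leb_rV R m O)%E.
Proof.
have [b b0 int_lin] := ge0_integral_linear (frame_unitmx fhQ).
have [k k0 kE] := pos_lty_EFin (@arcsine_mass_gt0 R) (@arcsine_mass_lty R).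
have sa0 : 0 < Num.sqrt a by rewrite sqrtr_gt0.
exists (((Num.sqrt a)^-1 * k) / b); first by rewrite divr_gt0// mulr_gt0// invr_gt0.
move=> O mO OD.
pose F x := (w x * \1_O (x *m Q^T))%:E.
have F0 x : (0 <= F x)%E by rewrite lee_fin mulr_ge0// ell_density_ge0.
have mF : measurable_fun setT F.
  apply/measurable_EFinP; apply: measurable_funM; first exact: measurable_ell_density.
  apply: (@measurableT_comp _ _ _ _ _ _ (\1_O : 'rV[R]_m -> R)); last exact: measurable_mulmxr.
  exact: measurable_indic.
have {}int_lin := int_lin F mF F0.
have -> : (\int[leb_rV R (1 + m)]_x F x =
    (b^-1)%:E * \int[leb_rV R (1 + m)]_x F (x *m col_mx h Q))%E.
  by rewrite int_lin muleA -EFinM mulVf ?mul1e// gt_eqF.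
rewrite mulrC EFinM -muleA; congr (_ * _)%E.
rewrite leb_rV_tonelli//; last first.
  exact: (measurableT_comp mF (measurable_mulmxr _)).
rewrite -(integral_indicT (leb_rV R m) mO) -ge0_integralZl_EFin//; first last.
- by rewrite mulr_ge0// ?ltW// invr_gt0.
- by apply/measurable_EFinP; exact: measurable_indic.
apply: eq_integral => y _.
transitivity (\int[lebesgue_measure]_t ((\1_O y)%:E * (w (t *: h + y *m Q))%:E))%E.
  apply: eq_integral => t _.
  by rewrite /F rV_cons_frame (frame_coord fhQ) mulrC EFinM.
rewrite ge0_integralZl_EFin//; first last.
- apply/measurable_EFinP.
  rewrite (_ : (fun t => _) = fun t => w (rV_cons (y, t) *m col_mx h Q)); last first.
    by apply/funext => t; rewrite rV_cons_frame.
  apply: (measurableT_comp (measurable_ell_density A c)).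
  apply: (measurableT_comp (measurable_mulmxr _)).
  by apply: (measurableT_comp measurable_rV_cons).
- by move=> t _; rewrite lee_fin ell_density_ge0.
rewrite indicE; case: (boolP (y \in O)) => [|_]; last by rewrite mul0e mule0.
by rewrite inE mul1e mule1 => /OD /line_integral ->; rewrite kE -EFinM.
Qed.

Lemma open_shadow : open shadow.
Proof.
rewrite (_ : shadow = \bigcup_t ((fun y : 'rV[R]_m => t *: h + y *m Q) @^-1`
    [set x | q x < 1])); last first.
  by apply/seteqP; split => y [t]; [exists t|move=> _ ?; exists t].
apply: bigcup_open => t _; apply: open_comp; last exact: open_gauge_lt1.
have cf : continuous (fun y : 'rV[R]_m => t *: h + y *m Q).
  move=> y; apply: (@cvgD _ _ _ (nbhs y) _ (fun=> t *: h) (fun y => y *m Q)).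
    exact: cvg_cst.
  exact: continuous_mulmxr.
by move=> y _; exact: cf.
Qed.

(** The projection of the centre lies in the shadow, which is bounded as the
    ellipsoid is. *)
Lemma leb_rV_shadow : exists2 e : R, 0 < e & leb_rV R m shadow = e%:E.
Proof.
apply: pos_lty_EFin.
  apply: leb_rV_open_gt0; first exact: open_shadow.
  exists (c *m Q^T), (dot c h); rewrite -frame_decomp//.
  by rewrite /gauge subrr mul0mx /dot mul0mx mxE ltr01.
apply: (@leb_rV_bounded_lty _ _ _
  (\sum_j (\sum_i `|(A *m Q^T) i j| + `|(c *m Q^T) 0 j|))).
  exact: open_measurable_rV open_shadow.
move=> y j [t qt].
rewrite -(frame_coord fhQ t y).
set x := t *: h + y *m Q in qt *.
have -> : x *m Q^T = (x - c) *m invmx A *m (A *m Q^T) + c *m Q^T.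
  by rewrite mulmxA mulmxKV// -mulmxDl subrK.
rewrite mxE (bigD1 j)//=; apply: le_trans (ler_normD _ _) _.
apply: (@le_trans _ _ (\sum_i `|(A *m Q^T) i j| + `|(c *m Q^T) 0 j|)); last first.
  by rewrite lerDl sumr_ge0// => k _; rewrite addr_ge0// sumr_ge0.
rewrite lerD2r; apply: normr_mulmx_le => i.
by apply: normr_coord_le1; exact: ltW.
Qed.

(** Bases lie in the projection of the closed ellipsoid.  If [O] contains a
    neighbourhood of [y], it contains a point slightly beyond [y] as seen
    from the projection [y0] of the centre; contracting towards the centre a point
    of the ellipsoid above it gives a point of the open ellipsoid above [y]. *)
Lemma open_sub_shadow (O : set 'rV[R]_m) : open O ->
  O `<=` [set y | exists t, q (t *: h + y *m Q) <= 1] -> O `<=` shadow.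
Proof.
move=> oO OK y Oy.
pose y0 := c *m Q^T.
pose g (e : R) := y + e *: (y - y0).
have cg : {for 0, continuous g}.
  apply: continuousD; first exact: cst_continuous.
  apply: continuousZl; exact: cvg_id.
have : nbhs (g 0) O by rewrite /g scale0r addr0; exact: open_nbhs_nbhs.
move=> /cg /nbhs_ballP[e /= e0 eO].
have Oe : O (g (e / 2)).
  apply: eO; rewrite /ball /= sub0r normrN gtr0_norm ?divr_gt0//.
  by rewrite ltr_pdivrMr// ltr_pMr//; lra.
have [t qt] := OK _ Oe.
set x := t *: h + _ in qt.
have l0 : 0 < 1 + e / 2 by rewrite addr_gt0// divr_gt0.
pose x' := c + (1 + e / 2)^-1 *: (x - c).
have x'Q : x' *m Q^T = y.
  rewrite /x' mulmxDl -scalemxAl mulmxBl (frame_coord fhQ) -/y0 /g.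
  have -> : y + (e / 2) *: (y - y0) - y0 = (1 + e / 2) *: (y - y0).
    by rewrite scalerDl scale1r addrAC.
  by rewrite scalerA mulVf ?scale1r ?gt_eqF// addrC subrK.
exists (dot x' h); rewrite -{1}x'Q -frame_decomp// gauge_contract.
apply: (@le_lt_trans _ _ ((1 + e / 2)^-1 ^+ 2 * 1)).
  by rewrite ler_wpM2l ?sqr_ge0.
rewrite mulr1 exprn_ilt1 ?invr_ge0 ?ltW//.
by rewrite invf_lt1// ltrDl divr_gt0.
Qed.

End ellipsoid_sections.

(** * Cross-sectional volumes of packings *)

Lemma lebesgue_outer_ge0 (R : realType) (m : nat) (B : set 'rV[R]_m) :
  (0 <= lebesgue_outer B)%E.
Proof.
rewrite -(measure0 (leb_rV R m)).
apply: le_trans (leb_rV_le_outer measurable0) _.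
exact: lebesgue_outer_le.
Qed.

Lemma lee_div_fin (R : realType) (x y : \bar R) (a b : R) :
  (0 <= x)%E -> (x <= a%:E)%E -> 0 < b -> (b%:E <= y)%E ->
  (x / y <= (a / b)%:E)%E.
Proof.
move=> x0 xa b0.
have a0 : 0 <= a by have := le_trans x0 xa; rewrite lee_fin.
case: x x0 xa => [x||]//; rewrite !lee_fin => x0 xa.
case: y => [y||]//; rewrite ?lee_fin => bY.
  have y0 : 0 < y by exact: lt_le_trans bY.
  rewrite inver gt_eqF// -EFinM lee_fin; apply: ler_pM => //.
    by rewrite invr_ge0 ltW.
  by rewrite lef_pV2.
by rewrite mulr0 divr_ge0// ltW.
Qed.

Section crv_bound.
Context {R : realType} {n : nat}.
Local Notation m := n.+1.
Variables (A : 'M[R]_(1 + m)) (c : 'rV[R]_(1 + m)).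
Hypothesis uA : A \in unitmx.
Local Notation K := [set x | gauge A c x <= 1].
Local Notation w := (ell_density A c).

(** The part of [C] above the interior of its base carries a proportion
    [I / W] of the mass of the ellipsoid, and [crv K C] is at most this
    proportion: by regularity the base has at most the volume of its interior,
    and the closed projection has at least the volume of the shadow. *)
Lemma crv_le_density (C : cylinder R (1 + m) 1) :
  regular_base C -> cyl_base C `<=` orth_proj (cyl_orth C) K ->
  exists U : set 'rV[R]_(1 + m), exists I W : R,
  [/\ open U, U `<=` cyl_set C, 0 < W,
      (\int[leb_rV R (1 + m)]_x (w x)%:E = W%:E)%E &
      (\int[leb_rV R (1 + m)]_x (w x * \1_U x)%:E = I%:E)%E /\
      (crv K C <= (I / W)%:E)%E].
Proof.
move=> reg BK.
have [h HE] := coords_frame C.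
set Q := xget _ _ => fhQ.
have EE : cyl_orth C = orth [set t *: h | t in [set: R]] by rewrite /cyl_orth HE.
pose B : set 'rV[R]_m := [set y | cyl_base C (y *m Q)].
pose Z : set 'rV[R]_m :=
  [set y | (cyl_base C `\` relint (cyl_orth C) (cyl_base C)) (y *m Q)].
pose V : set 'rV[R]_m := B°.
have oV : open V by exact: open_interior.
have VB : V `<=` B by exact: interior_subset.
have Z0 : lebesgue_outer Z = 0%E by exact: reg.
have BV : (lebesgue_outer B <= leb_rV R m V)%E.
  apply: lebesgue_outer_le_open Z0 _ => // y By.
  have [yr|yr] := pselect (relint (cyl_orth C) (cyl_base C) (y *m Q)).
    by left; rewrite EE in yr; exact: (coords_relint fhQ).
  by right.
pose S : set 'rV[R]_m := [set y | orth_proj (cyl_orth C) K (y *m Q)].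
have SP y : S y <-> exists t, gauge A c (t *: h + y *m Q) <= 1.
  by rewrite /S /= EE; exact: (orth_projP fhQ).
pose D := shadow A c h Q.
have mD : measurable D by apply: open_measurable_rV; exact: open_shadow.
have VD : V `<=` D.
  by apply: (open_sub_shadow fhQ) => // y /VB By; apply/SP; exact: BK.
have DS : (leb_rV R m D <= lebesgue_outer S)%E.
  apply: le_trans (leb_rV_le_outer mD) _; apply: lebesgue_outer_le => y [t /ltW qt].
  by apply/SP; exists t.
have [e e0 eE] := ell_density_projection c uA fhQ.
have [dl dl0 dlE] := leb_rV_shadow c uA fhQ.
have [v vE] : exists v : R, leb_rV R m V = v%:E.
  have : (leb_rV R m V <= dl%:E)%E.
    by rewrite -dlE; apply: le_measure VD; rewrite inE//; exact: open_measurable_rV.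
  have : (0 <= leb_rV R m V)%E by exact: measure_ge0.
  by case: (leb_rV R m V) => [v||]// _ _; exists v.
exists [set x | V (x *m Q^T)], (e * v), (e * dl); split => /=.
- by apply: open_comp oV => x _; exact: continuous_mulmxr.
- move=> x /VB /= Bx; exists (x *m Q^T *m Q) => //.
  exists (dot x h *: h); first by rewrite HE; exists (dot x h).
  by rewrite addrC -frame_decomp.
- by rewrite mulr_gt0.
- rewrite EFinM -dlE -(eE D mD (@subset_refl _ _)).
  apply: eq_integral => x _; congr EFin; rewrite indicE.
  case: (boolP (_ \in _)) => [|/negP xD]; first by rewrite mulr1.
  rewrite mulr0; apply: ell_density_out; rewrite leNgt; apply/negP => qx.
  by apply: xD; rewrite inE; exists (dot x h); rewrite -frame_decomp.
split; first by rewrite EFinM -vE -eE//; exact: open_measurable_rV.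
have -> : e * v / (e * dl) = v / dl by field; rewrite !gt_eqF.
apply: (@lee_div_fin _ (lebesgue_outer B) (lebesgue_outer S)) => //.
- exact: lebesgue_outer_ge0.
- by rewrite -vE.
- by rewrite -dlE.
Qed.

End crv_bound.

Theorem theorem4p2 (R : realType) (d : nat) (hd : (2 <= d)%N)
    (K : set 'rV[R]_d) (hK : ellipsoid K) (r : nat) (hr : (1 <= r)%N)
    (N : nat) (C : 'I_N -> cylinder R d 1)
    (hreg : forall i, regular_base (C i))
    (hC : fold_packing r K C) :
  (\sum_(i < N) crv K (C i) <= r%:R%:E)%E.
Proof.
case: d hd K hK C hreg hC => [|[|n]]// _ K [A [c [uA KE]]] C hreg [BK pack].
rewrite (ellipsoid_gaugeE _ uA) in KE; subst K.
pose w : 'rV[R]_(1 + n.+1) -> R := ell_density A c.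
have [U UP] := choice (fun i => crv_le_density uA (hreg i) (BK i)).
have [I IP] := choice UP.
(* The total mass [W] of the ellipsoid is known to be finite and positive
   through any of the cylinders, hence the case distinction. *)
have [N0|[W [W0 WE]]] : N = 0%N \/ exists W : R, 0 < W /\
    (\int[leb_rV R (1 + n.+1)]_x (w x)%:E = W%:E)%E.
- case: N C {hreg BK pack UP} U I IP => [|N] C U I IP; first by left.
  by right; have [W [_ _ W0 WE _]] := IP ord0; exists W.
- by subst N; rewrite big_ord0 lee_fin.
pose F i x := (w x * \1_(U i) x)%:E.
have mw : measurable_fun setT w by exact: measurable_ell_density.
have mF i : measurable_fun setT (F i).
  apply/measurable_EFinP; apply: measurable_funM => //.
  have [_ [oU _ _ _ _]] := IP i.
  by apply: measurable_indic; exact: open_measurable_rV.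
have w0 x : 0 <= w x by exact: ell_density_ge0.
have F0 i x : (0 <= F i x)%E by rewrite lee_fin mulr_ge0.
have crvF i : (crv [set x | (gauge A c x <= 1)%R] (C i) <= (I i / W)%:E)%E.
  by have [W' [_ _ _ + [_ h]]] := IP i; rewrite WE => -[->].
have FI i : (\int[leb_rV R (1 + n.+1)]_x F i x = (I i)%:E)%E.
  by have [W' [_ _ _ _ []]] := IP i.
apply: (@le_trans _ _ (\sum_(i < N) (I i / W)%:E)%E); first exact: lee_sum.
rewrite sumEFin lee_fin -mulr_suml ler_pdivrMr// -lee_fin -sumEFin.
under eq_bigr do rewrite -FI.
rewrite -ge0_integral_sum//.
rewrite EFinM -WE -ge0_integralZl_EFin//; first last.
- exact/measurable_EFinP.
- by move=> x _; rewrite lee_fin.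
apply: ge0_le_integral => //.
- by move=> x _; apply: sume_ge0.
- by apply: emeasurable_sum.
- by apply/measurable_EFinP; apply: measurable_funM.
move=> x _; rewrite /F sumEFin -EFinM lee_fin -mulr_sumr mulrC.
have [qx|qx] := leP 1 (gauge A c x).
  by rewrite /w ell_density_out// !mulr0.
(* At a point of the open ellipsoid, being in [U i] implies being interior to
   the intersection of the i-th cylinder with K. *)
rewrite ler_wpM2r// (eq_bigr (fun i => (x \in U i)%:R)) //.
rewrite -natr_sum ler_nat -big_mkcond sum1_card.
apply: leq_trans (pack x (ltW qx)); apply/subset_leq_card/fintype.subsetP => i.
have [_ [oU UC _ _ _]] := IP i.
rewrite !inE => Ux.
have oUJ := openI oU (@open_gauge_lt1 _ _ A c).
have : U i `&` [set x | gauge A c x < 1] `<=`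
    (cyl_set (C i) `&` [set x | gauge A c x <= 1])°.
  by rewrite -open_subsetE// => y [/UC Cy /ltW qy].
by move=> sub; exact: (sub x (conj Ux qx)).
Qed.
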